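(* Let $p>1$ and let $G=(V,E)$ be a finite connected graph with vertex measure $\mu$ and symmetric edge measure $\omega$. For any given $f\in C(V)$, there exists a solution $u\in C(V)$ to the equation $\Delta_p u=\overline{f}-f$ on $V$. Moreover, if $u'\in C(V)$ is also a solution, then $u'$ differs from $u$ by a constant.
   Context: $G=(V,E)$ is a finite connected graph with vertex set $V$ and edge set $E$; $i\sim j$ means that $i,j\in V$ are joined by an edge. $\mu:V\to(0,+\infty)$ is a fixed vertex measure and $\omega:E\to(0,+\infty)$ is a fixed edge measure, symmetric: $\omega_{ij}=\omega_{ji}$ for each edge $i\sim j$. $C(V)$ is the finite-dimensional vector space of all real functions on $V$. For $p>1$ the discrete $p$-Laplacian $\Delta_p:C(V)\to C(V)$ is $$\Delta_p f_i=\frac{1}{\mu_i}\sum_{j\sim i}\omega_{ij}|f_j-f_i|^{p-2}(f_j-f_i),\qquad i\in V,$$ where $|t|^{p-2}t$ is understood to be $0$ at $t=0$. For $f\in C(V)$, $\overline{f}=\big(\sum_{i\in V}\mu_i f_i\big)/\big(\sum_{i\in V}\mu_i\big)$ is the average of $f$ with respect to $\mu$ (also regarded as a constant function). *)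

(* Defs.v *)
From mathcomp Require Import all_boot all_order all_algebra.
From mathcomp Require Import reals exp.

Set Implicit Arguments.
Unset Strict Implicit.
Unset Printing Implicit Defensive.

Import Order.TTheory GRing.Theory Num.Theory.

Local Open Scope ring_scope.

(* A finite simple graph is a finType V with an adjacency relation adj that is
   symmetric and irreflexive; C(V) is the function type V -> R. *)

Definition connected_graph (V : finType) (adj : rel V) : Prop :=
  (0 < #|V|)%N /\ forall i j : V, connect adj i j.

(* omega is total on V * V, but its values off the edges are never used. *)
Definition edge_measure (R : realType) (V : finType) (adj : rel V)
    (omega : V -> V -> R) : Prop :=
  forall i j : V, adj i j -> 0 < omega i j /\ omega i j = omega j i.

(* When p <> 2 the library has 0 `^ (p - 2) = 0, and for p = 2 it has
   0 `^ 0 = 1; in both cases the factor f j - f i makes the summand 0 when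
   f j = f i, as required by the convention |t|^(p-2) t = 0 at t = 0. *)
Definition plaplacian (R : realType) (V : finType) (adj : rel V)
    (mu : V -> R) (omega : V -> V -> R) (p : R) (f : V -> R) : V -> R :=
  fun i => (mu i)^-1 *
    \sum_(j | adj i j) omega i j * (`|f j - f i| `^ (p - 2) * (f j - f i)).

Definition average (R : realType) (V : finType) (mu : V -> R) (f : V -> R) : R :=
  (\sum_i mu i * f i) / \sum_i mu i.

(* Main.v *)
Require Import Defs.
From mathcomp Require Import all_boot all_order all_algebra.
From mathcomp Require Import reals exp.
From mathcomp Require Import boolp classical_sets topology normedtype derive.
From mathcomp Require Import ring lra.

Set Implicit Arguments.
Unset Strict Implicit.
Unset Printing Implicit Defensive.

Import Order.TTheory GRing.Theory Num.Theory.
Import numFieldNormedType.Exports.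

Local Open Scope classical_set_scope.
Local Open Scope ring_scope.

(** The equation is the Euler-Lagrange equation of a convex energy. Put
    [b i = mu i * (average mu f - f i)], so that [\sum_i b i = 0], and let
    [phi t = |t|^(p-2) t]. Then [u] is a solution if and only if
    [\sum_(j ~ i) omega i j * phi (u j - u i) = b i] for all [i], that is, if
    and only if [u] is a critical point of
    [E u = \sum_i \sum_(j ~ i) omega i j * |u j - u i|^p
      + 2 p * \sum_i b i * u i].

    Existence. Since the [b i] sum to zero, [E] is invariant under adding
    constants to [u], which allows the normalization [u i0 = 0] at a fixed
    vertex [i0]. Connectedness bounds such a [u] by [#|V|] times its largest
    increment [m] along an edge, while [E u] is at least a positive multiple of
    [m^p] minus a multiple of [m]. As [p > 1], the normalized functions with
    [E u <= 0] are therefore bounded ([energy_coercive]), and the minimum of [E]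
    on a large box is a global minimum ([energy_min]). That a minimizer is
    critical ([energy_critical]) is obtained without differentiating [E]:
    Young's inequality gives
    [|a|^p + p * phi a * (b - a) <= |b|^p] ([powR_norm_tangent]), hence a lower
    bound of [E v - E u] by the first variation of [E] at [u]
    ([energy_tangent]), and this together with the continuity of [phi] suffices.

    Uniqueness. If [u] and [v] are both solutions, pairing the difference of the
    two equations with [v - u] and summing by parts gives a vanishing sum of
    terms [omega i j * (phi a' - phi a) * (a' - a)], where [a] and [a'] are the
    increments of [u] and [v] along an edge. All of them are nonnegative because
    [phi] is monotone, so all are zero; as [phi] is injective, [a' = a] on every
    edge, and [v - u] is constant by connectedness ([flux_inj]). *)

(** * The odd power function *)

(** The function [|t|^(p-2) t]. With the conventions of [powR] at the base 0,
    its value at [t = 0] is 0 for every [p]. *)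
Definition signed_pow {R : realType} (p t : R) : R := `|t| `^ (p - 2) * t.

Section SignedPow.
Context {R : realType} (p : R) (p_gt1 : 1 < p).
Local Notation phi := (signed_pow p).

Lemma signed_pow0 : phi 0 = 0.
Proof. by rewrite /signed_pow mulr0. Qed.

Lemma signed_powN t : phi (- t) = - phi t.
Proof. by rewrite /signed_pow normrN mulrN. Qed.

Lemma norm_signed_pow t : `|phi t| = `|t| `^ (p - 1).
Proof.
have [->|t0] := eqVneq t 0.
  by rewrite signed_pow0 normr0 powR0 // subr_eq0 gt_eqF.
rewrite normrM ger0_norm ?powR_ge0 // -{2}(powRr1 (normr_ge0 t)) -powRD.
  by congr (_ `^ _); ring.
by rewrite normr_eq0 t0 implybT.
Qed.

Lemma signed_powM t : phi t * t = `|t| `^ p.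
Proof.
rewrite -(mulr_powRB1 (normr_ge0 t) (lt_trans ltr01 p_gt1)) -norm_signed_pow.
rewrite -normrM mulrC ger0_norm // /signed_pow mulrCA.
by rewrite mulr_ge0 ?powR_ge0 // -expr2 sqr_ge0.
Qed.

(** The graph of [|.|^p] lies above its tangent at [a]. This is Young's
    inequality for [|phi a|] and [|b|] with exponents [p / (p - 1)] and [p]. *)
Lemma powR_norm_tangent a b :
  `|a| `^ p + p * phi a * (b - a) <= `|b| `^ p.
Proof.
have p0 : 0 < p := lt_trans ltr01 p_gt1.
have p10 : 0 < p - 1 by rewrite subr_gt0.
have q0 : 0 < p / (p - 1) by rewrite divr_gt0.
have pN0 : p != 0 by rewrite gt_eqF.
have p1N0 : p - 1 != 0 by rewrite gt_eqF.
have conj : (p / (p - 1))^-1 + p^-1 = 1 by field; rewrite pN0 p1N0.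
have := conjugate_powR (normr_ge0 (phi a)) (normr_ge0 b) q0 p0 conj.
rewrite norm_signed_pow -powRrM.
rewrite (_ : (p - 1) * (p / (p - 1)) = p); last by field.
rewrite -norm_signed_pow -normrM => young.
have := le_trans (ler_norm _) young.
rewrite -(ler_pM2l p0) mulrDr.
rewrite (_ : p * (_ / (p / _)) = (p - 1) * `|a| `^ p);
  last by field; rewrite pN0 p1N0.
rewrite (_ : p * (_ / p) = `|b| `^ p); last by field.
have := signed_powM a; set x := phi a; set y := _ `^ p => xa.
rewrite (_ : p * x * (b - a) = p * (x * b) - p * (x * a)); last by ring.
rewrite xa mulrBl mul1r; lra.
Qed.

(** The tangent inequalities at [a] and at [b], added together. *)
Lemma signed_pow_monotone a b : 0 <= (phi a - phi b) * (a - b).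
Proof.
have p0 : 0 < p := lt_trans ltr01 p_gt1.
have := lerD (powR_norm_tangent a b) (powR_norm_tangent b a).
set x := `|a| `^ p; set y := `|b| `^ p => h.
rewrite -(pmulr_rge0 _ p0) -subr_ge0.
move: h; rewrite -subr_ge0 => /le_trans; apply.
by rewrite le_eqVlt; apply/orP; left; apply/eqP; ring.
Qed.

Lemma signed_pow_inj : injective phi.
Proof.
move=> a b ab; have p10 : 0 < p - 1 by rewrite subr_gt0.
have nab : `|a| = `|b|.
  apply: (powR_injective p10); rewrite ?nnegrE //.
  by rewrite -!norm_signed_pow ab.
move: ab; rewrite /signed_pow nab.
have [b0 _|b0] := eqVneq b 0.
  by apply/eqP; rewrite b0 -normr_eq0 nab b0 normr0.
by apply: mulfI; rewrite powR_eq0 normr_eq0 (negbTE b0).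
Qed.

Lemma continuous_powR_norm (q : R) : 0 < q -> continuous (fun t : R => `|t| `^ q).
Proof.
move=> q0 t; have [->|t0] := eqVneq t 0.
  rewrite /continuous_at normr0 powR0 ?gt_eqF //.
  apply/cvgr0Pnorm_lt => e e0.
  have d0 : 0 < e `^ q^-1 by rewrite powR_gt0.
  near=> s.
  have se : `|s| < e `^ q^-1.
    by near: s; apply: (@pseudometric_normed_Zmodule.nbhs0_lt R R).
  rewrite ger0_norm ?powR_ge0 //.
  rewrite -[e](powRr1 (ltW e0)) -(mulVf (lt0r_neq0 q0)) powRrM.
  by apply: gt0_ltr_powR; rewrite ?nnegrE ?powR_ge0.
have nt0 : 0 < `|t| by rewrite normr_gt0.
apply: (@continuous_comp _ _ _ (fun s : R => `|s|) (fun x => x `^ q)).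
  exact: norm_continuous.
apply/differentiable_continuous/derivable1_diffP/derivable_powR.
by rewrite in_itv /= nt0.
Unshelve. all: by end_near. Qed.

Lemma continuous_signed_pow : continuous phi.
Proof.
move=> t; have [->|t0] := eqVneq t 0.
  rewrite /continuous_at signed_pow0; apply/norm_cvg0P.
  rewrite [X in X @ _](_ : _ = fun s : R => `|s| `^ (p - 1)); last first.
    by apply: funext => s; rewrite norm_signed_pow.
  have q0 : 0 < p - 1 by rewrite subr_gt0.
  have := @continuous_powR_norm _ q0 0.
  by rewrite /continuous_at normr0 powR0 ?gt_eqF.
have nt0 : 0 < `|t| by rewrite normr_gt0.
apply: cvgM; last exact: cvg_id.
apply: (@continuous_comp _ _ _ (fun s : R => `|s|) (fun x => x `^ (p - 2))).
  exact: norm_continuous.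
apply/differentiable_continuous/derivable1_diffP/derivable_powR.
by rewrite in_itv /= nt0.
Qed.

End SignedPow.

(** * Functions on a finite graph *)

Section Graph.
Context {R : realType} {V : finType} {adj : rel V}.

(** A path without repeated vertices has fewer than [#|V|] edges, so a bound
    [m] on the increments along edges gives the bound [#|V| * m] on the
    oscillation over a connected component. *)
Lemma connect_osc (u : V -> R) (m : R) :
  0 <= m -> (forall i j, adj i j -> `|u j - u i| <= m) ->
  forall i j, connect adj i j -> `|u j - u i| <= #|V|%:R * m.
Proof.
move=> m0 um i j /connectP[s si ->] {j}.
case/shortenP: si => s' si us' _.
have {us'} ss' : (size s' <= #|V|)%N.
  by apply: leq_trans (max_card (mem s')); case/andP: us' => _ /card_uniqP ->.
apply: (@le_trans _ _ ((size s')%:R * m)); last first.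
  by rewrite ler_wpM2r // ler_nat.
elim: s' i si {ss' s} => [|j s ih] i /=; first by rewrite subrr normr0 mul0r.
move=> /andP[ij /ih js].
rewrite -(subrK (u j) (u (last j s))) -addrA -natr1 mulrDl mul1r.
by apply: le_trans (ler_normD _ _) _; rewrite lerD // um.
Qed.

(** Every edge occurs in the double sum with both orientations; as [F] is odd,
    the parts carrying [h j] and [h i] contribute equally. *)
Lemma summation_by_parts (omega : V -> V -> R) (F : R -> R) (u h : V -> R) :
  symmetric adj -> (forall i j, adj i j -> omega i j = omega j i) ->
  (forall t, F (- t) = - F t) ->
  \sum_i \sum_(j | adj i j) omega i j * (F (u j - u i) * (h j - h i)) =
  - (2 * \sum_i h i * \sum_(j | adj i j) omega i j * F (u j - u i)).
Proof.
move=> adj_sym omega_sym F_odd.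
pose S := \sum_i \sum_(j | adj i j) h i * (omega i j * F (u j - u i)).
have -> : \sum_i h i * \sum_(j | adj i j) omega i j * F (u j - u i) = S.
  by apply: eq_bigr => i _; rewrite big_distrr.
transitivity (\sum_i \sum_(j | adj i j) h j * (omega i j * F (u j - u i)) - S).
  rewrite -sumrB; apply: eq_bigr => i _; rewrite -sumrB.
  by apply: eq_bigr => j _; ring.
have -> : \sum_i \sum_(j | adj i j) h j * (omega i j * F (u j - u i)) = - S.
  rewrite (exchange_big_dep xpredT) //= /S -sumrN; apply: eq_bigr => i _.
  rewrite -sumrN; apply: eq_big => [j|j ij]; first by rewrite adj_sym.
  by rewrite (omega_sym _ _ ij) -opprB F_odd; ring.
by ring.
Qed.

(** [m] is the largest increment of [u] along an edge, or 0 if there is no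
    edge. *)
Lemma max_edge_le_sum (p : R) (u : V -> R) : 0 < p ->
  exists m : R, [/\ 0 <= m, forall i j, adj i j -> `|u j - u i| <= m &
    m `^ p <= \sum_i \sum_(j | adj i j) `|u j - u i| `^ p].
Proof.
move=> p0; pose d (e : V * V) := `|u e.2 - u e.1|.
have sum_ge0 i : 0 <= \sum_(j | adj i j) `|u j - u i| `^ p.
  by apply: sumr_ge0 => j _; exact: powR_ge0.
have [/existsP[e0 e0adj]|/existsPn noe] :=
  boolP [exists e : V * V, adj e.1 e.2]; last first.
  exists 0; split=> // [i j ij|]; first by have := noe (i, j); rewrite /= ij.
  by rewrite powR0 ?gt_eqF // sumr_ge0.
case: (@Order.TotalTheory.arg_maxP _ _ _ e0 (fun e => adj e.1 e.2) d e0adj)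
  => -[a b] /= ab dmax.
exists (d (a, b)); split=> [|i j ij|]; first exact: normr_ge0.
  exact: (dmax (i, j)).
rewrite (bigD1 a) //= (bigD1 b) //= -addrA lerDl addr_ge0 //.
  by apply: sumr_ge0 => j _; exact: powR_ge0.
by apply: sumr_ge0.
Qed.

End Graph.

(** * The p-energy *)

Lemma continuous_sum {R : realType} {I : finType} (P : pred I)
    {T : topologicalType} (h : I -> T -> R) :
  (forall i, P i -> continuous (h i)) ->
  continuous (fun x => \sum_(i | P i) h i x).
Proof. by apply: continuous_big; exact: add_continuous. Qed.

Section Energy.
Context {R : realType} {V : finType} {adj : rel V} {omega : V -> V -> R}.
Context {p : R} (p_gt1 : 1 < p) (adj_sym : symmetric adj).
Context (adj_conn : connected_graph adj) (omegaP : edge_measure adj omega).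
Local Notation phi := (signed_pow p).

(** The p-Laplacian of [u] at [i], multiplied by [mu i]. *)
Definition flux (u : V -> R) (i : V) : R :=
  \sum_(j | adj i j) omega i j * phi (u j - u i).

(** Uniqueness up to a constant. *)
Lemma flux_inj (u v : V -> R) : (forall i, flux u i = flux v i) ->
  exists c, forall i, v i = u i + c.
Proof.
move=> uv; pose h i := v i - u i.
have omega_sym i j : adj i j -> omega i j = omega j i by move/omegaP => [].
have parts w : \sum_i \sum_(j | adj i j)
    omega i j * (phi (w j - w i) * (h j - h i)) = - (2 * \sum_i h i * flux w i).
  exact: summation_by_parts adj_sym omega_sym (@signed_powN _ p).
pose T i j := omega i j * ((phi (v j - v i) - phi (u j - u i)) *
   ((v j - v i) - (u j - u i))).
have T0 i j : adj i j -> 0 <= T i j.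
  move=> /omegaP[w0 _]; apply: mulr_ge0; first exact: ltW.
  exact: signed_pow_monotone.
have sumT : \sum_i \sum_(j | adj i j) T i j = 0.
  transitivity (- (2 * \sum_i h i * flux v i) - - (2 * \sum_i h i * flux u i)).
    rewrite -!parts -sumrB; apply: eq_bigr => i _; rewrite -sumrB.
    by apply: eq_bigr => j _; rewrite /T /h; ring.
  under eq_bigr do rewrite -uv.
  by rewrite subrr.
have hc i j : adj i j -> `|h j - h i| <= 0.
  move=> ij; have := T0 i j ij.
  have /psumr_eq0P - /(_ sumT) Ti : forall i, true -> 0 <= \sum_(j | adj i j) T i j.
    by move=> k _; apply: sumr_ge0 => l; exact: T0.
  have /psumr_eq0P - /(_ (Ti i isT) j ij) : forall j, adj i j -> 0 <= T i j.
    by move=> k; exact: T0.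
  move=> /eqP; rewrite !mulf_eq0 (gt_eqF (proj1 (omegaP ij))) /= !subr_eq0.
  move=> /orP[/eqP/(signed_pow_inj p_gt1) e _|/eqP e _];
    by rewrite normr_le0 /h; apply/eqP; lra.
have [/card_gt0P[i0 _] conn] := adj_conn.
exists (h i0) => i.
have := connect_osc (lexx 0) hc (conn i0 i).
by rewrite mulr0 normr_le0 subr_eq0 => /eqP <-; rewrite /h addrC subrK.
Qed.

(** The energy whose critical points are the solutions of [flux u = b]. The
    double sum counts every edge twice; the factor [2 * p] in the linear part
    accounts for this and for the derivative of [|t|^p]. *)
Definition energy (b u : V -> R) : R :=
  \sum_i \sum_(j | adj i j) omega i j * `|u j - u i| `^ p +
  2 * p * \sum_i b i * u i.

(** The first variation of the energy at [u] in the direction [v - u] is a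
    lower bound for the increment of the energy. *)
Lemma energy_tangent (b u v : V -> R) :
  energy b u + 2 * p * \sum_i (v i - u i) * (b i - flux u i) <= energy b v.
Proof.
have omega_sym i j : adj i j -> omega i j = omega j i by move/omegaP => [].
have parts := @summation_by_parts _ _ adj omega phi u (fun i => v i - u i)
  adj_sym omega_sym (@signed_powN _ p).
have -> : \sum_i (v i - u i) * (b i - flux u i) =
    (\sum_i b i * v i) - (\sum_i b i * u i) - \sum_i (v i - u i) * flux u i.
  by rewrite -!sumrB; apply: eq_bigr => i _; ring.
suff : \sum_i \sum_(j | adj i j) omega i j * `|u j - u i| `^ p +
    p * \sum_i \sum_(j | adj i j)
      omega i j * (phi (u j - u i) * (v j - u j - (v i - u i))) <=
    \sum_i \sum_(j | adj i j) omega i j * `|v j - v i| `^ p.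
  rewrite parts /energy -/(flux u).
  rewrite /flux; set x := \sum_i (v i - u i) * _; lra.
rewrite mulr_sumr -big_split; apply: ler_sum => i _ /=.
rewrite mulr_sumr -big_split; apply: ler_sum => j /omegaP[w0 _] /=.
apply: le_trans (ler_wpM2l (ltW w0) (powR_norm_tangent p_gt1 (u j - u i) _)).
by rewrite le_eqVlt; apply/orP; left; apply/eqP; ring.
Qed.

Lemma energy_shift (b u : V -> R) (c : R) : \sum_i b i = 0 ->
  energy b (fun i => u i - c) = energy b u.
Proof.
move=> b0; congr (_ + _).
  apply: eq_bigr => i _; apply: eq_bigr => j _; congr (_ * `|_| `^ _); ring.
congr (_ * _); under eq_bigr do rewrite mulrBr.
by rewrite sumrB -mulr_suml b0 mul0r subr0.
Qed.

(** If [m] is the largest increment of [u] along an edge and [C * omega >= 1] on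
    the edges, then [u i0 = 0] and [energy b u <= 0] force [m^p <= K m], where
    [K = 2 p C #|V| \sum_i |b i|]; hence [m <= K^(1/(p-1))]. *)
Lemma energy_coercive (b : V -> R) (i0 : V) :
  exists M : R, 0 <= M /\ forall u : V -> R, u i0 = 0 -> energy b u <= 0 ->
    forall i, `|u i| <= M.
Proof.
have p0 : 0 < p := lt_trans ltr01 p_gt1.
have p10 : 0 < p - 1 by rewrite subr_gt0.
(* The sum of the inverse weights bounds each of them, and so avoids choosing
   an edge of least weight. *)
pose C := \sum_i \sum_(j | adj i j) (omega i j)^-1.
have winv0 i j : adj i j -> 0 <= (omega i j)^-1.
  by move=> /omegaP[w0 _]; rewrite invr_ge0 ltW.
have C0 : 0 <= C by apply: sumr_ge0 => i _; apply: sumr_ge0 => j; exact: winv0.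
have wC i j : adj i j -> 1 <= C * omega i j.
  move=> ij; have [w0 _] := omegaP ij.
  rewrite -ler_pdivrMr // mul1r /C (bigD1 i) //= (bigD1 j) //= -addrA lerDl.
  rewrite addr_ge0 //; first by apply: sumr_ge0 => k /andP[]; auto.
  by apply: sumr_ge0 => k _; apply: sumr_ge0 => l; exact: winv0.
pose B := \sum_i `|b i|.
have B0 : 0 <= B by apply: sumr_ge0.
pose K := C * (2 * p * (B * #|V|%:R)).
have K0 : 0 <= K by rewrite !mulr_ge0 // ltW.
exists (#|V|%:R * K `^ (p - 1)^-1); split; first by rewrite mulr_ge0 // powR_ge0.
move=> u u0 Eu i.
have [m [m0 um mle]] := @max_edge_le_sum R V adj p u p0.
have osc j : `|u j| <= #|V|%:R * m.
  have := connect_osc m0 um (proj2 adj_conn i0 j).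
  by rewrite u0 subr0.
apply: le_trans (osc i) _; rewrite ler_wpM2l //.
have mK : m * m `^ (p - 1) <= m * K.
  rewrite mulr_powRB1 //; apply: le_trans mle _.
  apply: (@le_trans _ _
    (C * \sum_i \sum_(j | adj i j) omega i j * `|u j - u i| `^ p)).
    rewrite mulr_sumr; apply: ler_sum => k _.
    rewrite mulr_sumr; apply: ler_sum => l kl.
    by rewrite mulrA ler_peMl ?powR_ge0 // wC.
  rewrite /K mulrCA ler_wpM2l //.
  have bu : - (B * (#|V|%:R * m)) <= \sum_i b i * u i.
    rewrite -lerNl -sumrN /B mulr_suml; apply: ler_sum => j _.
    by apply: le_trans (ler_norm _) _; rewrite normrN normrM ler_wpM2l.
  have {}bu : - (2 * p * (B * (#|V|%:R * m))) <= 2 * p * \sum_i b i * u i.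
    by rewrite -mulrN ler_wpM2l // mulr_ge0 // ltW.
  have -> : m * (2 * p * (B * #|V|%:R)) = 2 * p * (B * (#|V|%:R * m)) by ring.
  move: Eu; rewrite /energy; lra.
have [m_le0|m_gt0] := leP m 0; first exact: le_trans m_le0 (powR_ge0 _ _).
move: mK; rewrite ler_pM2l // => mK.
have -> : m = (m `^ (p - 1)) `^ (p - 1)^-1.
  by rewrite -powRrM mulfV ?gt_eqF // powRr1.
by apply: ge0_ler_powR; rewrite ?nnegrE ?powR_ge0 // invr_ge0 ltW.
Qed.

(** Continuity of the energy along a continuous family [U] of functions on the
    vertices, over any topological space of parameters. *)
Lemma continuous_energy (T : topologicalType) (b : V -> R) (U : T -> V -> R) :
  (forall i, continuous (U ^~ i)) -> continuous (energy b \o U).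
Proof.
move=> cU x; apply: cvgD.
  apply: continuous_sum => i _; apply: continuous_sum => j _ y.
  apply: cvgM; first exact: cvg_cst.
  apply: (@continuous_comp _ _ _ (fun y => U y j - U y i)
    (fun t : R => `|t| `^ p)).
    by apply: cvgB; exact: cU.
  exact/continuous_powR_norm/(lt_trans ltr01 p_gt1).
apply: cvgM; first exact: cvg_cst.
apply: continuous_sum => i _ y.
by apply: cvgM; [exact: cvg_cst|exact: cU].
Qed.

Lemma continuous_flux (T : topologicalType) (U : T -> V -> R) (i : V) :
  (forall i, continuous (U ^~ i)) -> continuous (fun x => flux (U x) i).
Proof.
move=> cU; apply: continuous_sum => j _ x.
apply: cvgM; first exact: cvg_cst.
apply: (@continuous_comp _ _ _ (fun y => U y j - U y i) phi).
  by apply: cvgB; exact: cU.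
exact: continuous_signed_pow.
Qed.

Lemma energy_min (b : V -> R) : \sum_i b i = 0 ->
  exists u : V -> R, forall v, energy b u <= energy b v.
Proof.
move=> b0; have p0 : 0 < p := lt_trans ltr01 p_gt1.
have [/card_gt0P[i0 _] _] := adj_conn.
have [M [M0 coercive]] := energy_coercive b i0.
(* Functions on [V] are encoded as row vectors, where boxes are compact. *)
pose fn (x : 'rV[R]_#|V|) (i : V) : R := x ord0 (enum_rank i).
pose A := [set x : 'rV[R]_#|V| | forall k, x ord0 k \in `[- M, M]%R].
have A0 : A 0 by move=> k; rewrite mxE in_itv /= oppr_le0 M0.
have cA : compact A.
  exact: (@rV_compact R #|V| (fun=> `[- M, M]%classic)
    (fun=> @segment_compact R _ _)).
have cfn i : continuous (fun x => fn x i) by exact: coord_continuous.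
have cE : continuous (energy b \o fn) by exact: continuous_energy.
have [x _ xmin] := EVT_min_rV (ex_intro _ _ A0) cA (continuous_subspaceT cE).
exists (fn x) => v.
rewrite -(energy_shift v (v i0) b0); set w := fun i => _.
have E0 : energy b (fn 0) = 0.
  rewrite /energy big1 ?big1 ?mulr0 ?addr0 // => i _.
    by rewrite /fn mxE mulr0.
  apply: big1 => j _.
  by rewrite /fn !mxE subrr normr0 powR0 ?mulr0 // gt_eqF.
(* Either [w] lies in the box, or its energy exceeds that of 0, which does. *)
have [Ew|/ltW] := leP (energy b w) 0; last first.
  by apply: le_trans; rewrite -E0; apply: xmin; rewrite inE.
pose y : 'rV[R]_#|V| := \row_k w (enum_val k).
have -> : w = fn y by apply: funext => i; rewrite /fn mxE enum_rankK.
apply: xmin; rewrite inE => k; rewrite mxE in_itv /= -ler_norml.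
by apply: coercive => //; rewrite /w subrr.
Qed.

Lemma energy_critical (b u : V -> R) :
  (forall v, energy b u <= energy b v) -> forall i, flux u i = b i.
Proof.
move=> umin i; have p0 : 0 < p := lt_trans ltr01 p_gt1.
(* [u] is perturbed by [t] at the vertex [i]. Comparing [u] with the tangent
   bound at the perturbed function shows that [t * g t >= 0], so that [g 0 = 0]
   by continuity. *)
pose U t j := u j + (if j == i then t else 0).
pose g t := b i - flux (U t) i.
have tg t : 0 <= t * g t.
  have := le_trans (energy_tangent b (U t) u) (umin (U t)).
  rewrite gerDl pmulr_rle0 ?mulr_gt0 // (bigD1 i) //= big1 => [|j ji].
    by rewrite addr0 /U eqxx /g opprD addNKr mulNr oppr_le0.
  by rewrite /U (negbTE ji) addr0 subrr mul0r.
have cU k : continuous (U ^~ k).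
  move=> s; apply: cvgD; first exact: cvg_cst.
  by case: (k == i); [exact: cvg_id|exact: cvg_cst].
have cg : continuous g.
  move=> t; apply: cvgB; first exact: cvg_cst.
  exact: continuous_flux.
have g0 : g 0 = b i - flux u i.
  by congr (_ - flux _ _); apply: funext => j; rewrite /U if_same addr0.
apply/esym/eqP; rewrite -subr_eq0 -g0 eq_le; apply/andP; split.
  have cvg_l : g t @[t --> 0^'-] --> g 0 by apply: cvg_at_left_filter; exact: cg.
  rewrite -(cvg_lim _ cvg_l) //; apply: limr_le;
    first by apply/cvg_ex; exists (g 0).
  near=> t; rewrite -(nmulr_rge0 _ (x := t)) //.
have cvg_r : g t @[t --> 0^'+] --> g 0 by apply: cvg_at_right_filter; exact: cg.
rewrite -(cvg_lim _ cvg_r) //; apply: limr_ge;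
  first by apply/cvg_ex; exists (g 0).
by near=> t; rewrite -(pmulr_rge0 _ (x := t)) //.
Unshelve. all: by end_near. Qed.

Lemma flux_surj (b : V -> R) : \sum_i b i = 0 ->
  exists u, forall i, flux u i = b i.
Proof.
by move=> /energy_min[u umin]; exists u; exact: energy_critical.
Qed.

End Energy.

Theorem theorem2p2 (R : realType) (p : R) (V : finType) (adj : rel V)
    (mu : V -> R) (omega : V -> V -> R) (f : V -> R)
    (p_gt1 : 1 < p)
    (adj_sym : symmetric adj) (adj_irr : irreflexive adj)
    (adj_conn : connected_graph adj)
    (mu_gt0 : forall i : V, 0 < mu i)
    (omegaP : edge_measure adj omega) :
  exists u : V -> R,
    (forall i : V, plaplacian adj mu omega p u i = average mu f - f i) /\
    (forall u' : V -> R,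
      (forall i : V, plaplacian adj mu omega p u' i = average mu f - f i) ->
      exists c : R, forall i : V, u' i = u i + c).
Proof.
pose b i := mu i * (average mu f - f i).
have fluxE u i : plaplacian adj mu omega p u i = average mu f - f i <->
    flux (adj := adj) (omega := omega) (p := p) u i = b i.
  have muN0 : mu i != 0 by rewrite gt_eqF.
  rewrite /plaplacian /b -/(flux u i); split=> [<-|e].
    by rewrite mulVKf.
  apply: (mulfI muN0); rewrite mulVKf //; exact: e.
have b0 : \sum_i b i = 0.
  have [/card_gt0P[i0 _] _] := adj_conn.
  have sumN0 : \sum_i mu i != 0.
    rewrite gt_eqF // (bigD1 i0) //= ltr_pwDl // sumr_ge0 // => i _.
    exact: ltW.
  rewrite /b; under eq_bigr do rewrite mulrBr.
  by rewrite sumrB -mulr_suml /average mulrCA divff // mulr1 subrr.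
have [u ub] := flux_surj p_gt1 adj_sym adj_conn omegaP b0.
exists u; split=> [i|v vb]; first exact/fluxE.
apply: (flux_inj p_gt1 adj_sym adj_conn omegaP) => i.
by rewrite ub; apply/esym/fluxE.
Qed.
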